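(* Let $(\mathcal{A},\mu)$ be a multiarrangement in $\mathbb{K}^2$. Fix $\alpha=\alpha_x x+\alpha_y y\in S_1\setminus\{0\}$. Let $\mathcal{A}'=\mathcal{A}\cup\{\ker(\alpha)\}$ and let $\mu'$ be the map with $\mu'(\ker(\alpha))=\mu(\ker(\alpha))+1$ and $\mu'(H)=\mu(H)$ for $H\in\mathcal{A}\setminus\{\ker(\alpha)\}$. Let $(\theta_1,\theta_2)$ be a homogeneous basis for $D(\mathcal{A},\mu)$. Then the following algorithm $\mathtt{ALG1}$ can be carried out (all steps are well defined, and a polynomial $q$ as required in step (6) exists whenever that step is reached), and, for any choice of $q$ allowed in step (6), its output $(\theta_1',\theta_2')$ is a homogeneous basis for $D(\mathcal{A}',\mu')$. Input: $\theta_1,\theta_2$, $\alpha=\alpha_x x+\alpha_y y$, $m=\mu(\ker(\alpha))$. Output: $\theta_1',\theta_2'$. Procedure: (1) If $\deg(\theta_1)<\deg(\theta_2)$, then swap $\theta_1$ and $\theta_2$. (2) Let $g(x,y)=\frac{\theta_2(\alpha)}{\alpha^m}$. (3) If $g(\alpha_y,-\alpha_x)=0$, then let $\theta_1'=\alpha\cdot\theta_1$ and $\theta_2'=\theta_2$, and finish the procedure. (4) Let $f(x,y)=\frac{\theta_1(\alpha)}{\alpha^m}$. (5) If $f(\alpha_y,-\alpha_x)=0$, then let $\theta_1'=\theta_1$ and $\theta_2'=\alpha\cdot\theta_2$, and finish the procedure. (6) Let $q(x,y)$ be a homogeneous polynomial in $x,y$ of degree $\deg(\theta_1)-\deg(\theta_2)$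 satisfying $f(\alpha_y,-\alpha_x)+g(\alpha_y,-\alpha_x)\,q(\alpha_y,-\alpha_x)=0$. (7) Let $\theta_1'=\theta_1+q(x,y)\cdot\theta_2$ and $\theta_2'=\alpha\cdot\theta_2$.
   Context: Let $\mathbb{K}$ be a field, $V=\mathbb{K}^2$ with coordinates $x,y$, and $S=\mathbb{K}[x,y]=\bigoplus_{i\ge 0}S_i$ graded by degree, so $S_1$ is the space of linear forms. A central arrangement $\mathcal{A}$ is a finite collection of hyperplanes through the origin (i.e. lines through the origin) in $V$. A multiarrangement $(\mathcal{A},\mu)$ is a central arrangement $\mathcal{A}$ with a map $\mu:\mathcal{A}\to\mathbb{Z}_{>0}$; it is identified with the map $\mu$ from all hyperplanes through the origin to $\mathbb{Z}_{\ge 0}$ obtained by setting $\mu(H)=0$ for $H\notin\mathcal{A}$, so that $\mathcal{A}=\{H:\mu(H)\ne 0\}$. The module of logarithmic vector fields $D(\mathcal{A},\mu)$ is the $S$-module of all derivations $\theta=f\partial_x+g\partial_y$ with $f,g\in S$ such that $\theta(\alpha)$ lies in the ideal $(\alpha^{\mu(\ker(\alpha))})$ of $S$ for each $\alpha\in S_1\setminus\{0\}$. It is graded: $D(\mathcal{A},\mu)_i$ consists of those $f\partial_x+g\partial_y\in D(\mathcal{A},\mu)$ with $f,g\in S_i$. A nonzero element of $D(\mathcal{A},\mu)_i$ is homogeneous of degree $i$. A homogeneous basis is an $S$-module basis consisting of (two) homogeneous elements. *)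

(* Defs.v *)
From HB Require Import structures.
From mathcomp Require Import all_boot all_order all_algebra.
From mathcomp Require Import finmap mpoly.

Set Implicit Arguments.
Unset Strict Implicit.
Unset Printing Implicit Defensive.
Import GRing.Theory.
Local Open Scope ring_scope.

(* S = K[x,y] is {mpoly K[2]}, with x = 'X_0 and y = 'X_1.  Its graded piece
   S_d consists of the p with p \is d.-homog, so 0 belongs to every S_d.      *)

Section LinearForms.
Variable K : fieldType.

Definition evform (alpha : {mpoly K[2]}) (v : 'rV[K]_2) : K^o := alpha.@[v 0].

(* linfun is only meaningful on linear functions, i.e. here for alpha in S_1:
   see mem_kerform.                                                           *)
Definition kerform (alpha : {mpoly K[2]}) : {vspace 'rV[K]_2} :=
  lker (linfun (evform alpha)).

Lemma linformE (alpha : {mpoly K[2]}) : alpha \is 1.-homog ->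
  alpha = alpha@_U_(0) *: 'X_(0 : 'I_2) + alpha@_U_(1) *: 'X_(1 : 'I_2).
Proof.
move=> /dhomogP h; apply/mpolyP => m; rewrite mcoeffD !mcoeffZ !mcoeffX.
have [/eqP|hm] := boolP (mdeg m == 1%N); last first.
  rewrite memN_msupp_eq0; last by apply: contra hm => /h /= ->.
  have hU i : (U_(i)%MM == m) = false.
    by apply: contraNF hm => /eqP <-; rewrite mdeg1.
  by rewrite !hU !mulr0 addr0.
move=> /eqP; rewrite mdeg_eq1 => /existsP [i /eqP ->].
rewrite !eq_mnm1.
have [->|->] : i = 0 \/ i = 1.
- by case: i => [[|[|//]] hi]; [left|right]; apply/val_inj.
- by rewrite eqxx mulr1 mulr0 addr0.
by rewrite eqxx mulr1 mulr0 add0r.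
Qed.

Lemma evformE (alpha : {mpoly K[2]}) : alpha \is 1.-homog ->
  forall v, evform alpha v = alpha@_U_(0) * v 0 0 + alpha@_U_(1) * v 0 1.
Proof.
by move=> h v; rewrite /evform {1}(linformE h) mevalD !mevalZ !mevalXU.
Qed.

Lemma evform_linear (alpha : {mpoly K[2]}) : alpha \is 1.-homog ->
  linear (evform alpha).
Proof.
move=> h a u v; rewrite !(evformE h) !mxE /GRing.scale /=.
by rewrite !mulrDr addrACA !(mulrCA a).
Qed.

Lemma linfun_evform (alpha : {mpoly K[2]}) : alpha \is 1.-homog ->
  linfun (evform alpha) =1 evform alpha.
Proof.
move=> h v.
pose L := GRing.isLinear.Build K 'rV[K]_2 K^o *:%R _ (evform_linear h).
pose f : {linear 'rV[K]_2 -> K^o} := HB.pack (evform alpha) L.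
exact: (lfunE f).
Qed.

Lemma mem_kerform (alpha : {mpoly K[2]}) (v : 'rV[K]_2) :
  alpha \is 1.-homog -> (v \in kerform alpha) = (alpha.@[v 0] == 0).
Proof. by move=> h; rewrite memv_ker linfun_evform. Qed.

Lemma dim_kerform (alpha : {mpoly K[2]}) :
  alpha \is 1.-homog -> alpha != 0 -> \dim (kerform alpha) = 1%N.
Proof.
move=> h h0; have := limg_ker_dim (linfun (evform alpha)) fullv.
rewrite capfv dimvf /dim /= -/(kerform alpha) mul1n.
set I := (_ @: _)%VS => e.
have hI : (\dim I <= 1)%N by have := dimvS (subvf I); rewrite dimvf.
suff : \dim I != 0%N by move: hI e; case: (\dim I) => [|[|]] // _; rewrite addn1 => -[].
rewrite dimv_eq0; apply: contra h0 => /eqP I0.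
have z v : evform alpha v = 0.
  rewrite -(linfun_evform h); apply/eqP; rewrite -memv0 -I0.
  exact/memv_img/memvf.
have := z (delta_mx 0 0); have := z (delta_mx 0 1).
rewrite !(evformE h) !mxE /= !(mulr1, mulr0, addr0, add0r) => a1 a0.
by rewrite (linformE h) a0 a1 !scale0r addr0.
Qed.

End LinearForms.

Section Multiarrangements.
Variable K : fieldType.

(* mult is the extension by 0 of mu to all subspaces of K^2; marr_suppP then
   makes it nonzero exactly on the lines of the arrangement.                  *)
Record multiarr := MultiArr {
  marr : {fset {vspace 'rV[K]_2}};
  mult :> {vspace 'rV[K]_2} -> nat;
  marr_dim : forall H, H \in marr -> \dim H = 1%N;
  marr_suppP : forall H, (H \in marr) = (mult H != 0%N)
}.

Section AddLine.
Variables (M : multiarr) (alpha : {mpoly K[2]}).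
Hypotheses (alpha1 : alpha \is 1.-homog) (alpha0 : alpha != 0).

Definition add_marr : {fset {vspace 'rV[K]_2}} :=
  (kerform alpha |` marr M)%fset.

Definition add_mult (H : {vspace 'rV[K]_2}) : nat :=
  if H == kerform alpha then (M (kerform alpha)).+1 else M H.

Lemma add_marr_dim H : H \in add_marr -> \dim H = 1%N.
Proof.
by rewrite !inE => /orP [/eqP ->|/marr_dim//]; apply: dim_kerform.
Qed.

Lemma add_marr_suppP H : (H \in add_marr) = (add_mult H != 0%N).
Proof. by rewrite !inE /add_mult; case: eqP => //= _; apply: marr_suppP. Qed.

Definition add_line : multiarr := MultiArr add_marr_dim add_marr_suppP.

End AddLine.
End Multiarrangements.

Section LogarithmicFields.
Variable K : fieldType.

(* The row vector (f, g) stands for the derivation f d/dx + g d/dy. *)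
Definition der := 'rV[{mpoly K[2]}]_2.

Definition app_der (theta : der) (p : {mpoly K[2]}) : {mpoly K[2]} :=
  theta 0 0 * p^`M(0) + theta 0 1 * p^`M(1).

Definition logder (M : multiarr K) (theta : der) : Prop :=
  forall alpha : {mpoly K[2]}, alpha \is 1.-homog -> alpha != 0 ->
    exists p, app_der theta alpha = p * alpha ^+ M (kerform alpha).

Definition homog_der (d : nat) (theta : der) : Prop :=
  theta != 0 /\ forall i, theta 0 i \is d.-homog.

(* msize is 1 + the total degree, and 0 at 0. *)
Definition deg_der (theta : der) : nat := (\max_(i < 2) msize (theta 0%R i)).-1.

Lemma deg_derE d theta : homog_der d theta -> deg_der theta = d.
Proof.
move=> [nz h]; rewrite /deg_der.
have hm i : theta 0 i != 0 -> msize (theta 0 i) = d.+1.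
  move=> i0; have := dhomog_uniq i0 (h i) (dhomog_msize (h i)).
  by move: i0; rewrite -msize_poly_eq0; case: (msize _) => //= k _ ->.
have hs i : (msize (theta 0%R i) <= d.+1)%N.
  by have [->|/hm ->//] := eqVneq (theta 0 i) 0; rewrite msize0.
have [i hi] : exists i, theta 0 i != 0.
  by apply/existsP; apply: contraR nz => /existsPn z; apply/eqP/rowP => i;
    rewrite mxE; apply/eqP; move: (z i); rewrite negbK.
suff -> : (\max_(j < 2) msize (theta 0%R j))%N = d.+1 by [].
apply/eqP; rewrite eqn_leq; apply/andP; split; first by apply/bigmax_leqP.
by rewrite -(hm i hi); apply: (leq_bigmax i).
Qed.

Definition is_basis (D : der -> Prop) (theta1 theta2 : der) : Prop :=
  [/\ D theta1, D theta2,
      forall theta, D theta ->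
        exists a b : {mpoly K[2]}, theta = a *: theta1 + b *: theta2
    & forall a b : {mpoly K[2]}, a *: theta1 + b *: theta2 = 0 ->
        a = 0 /\ b = 0].

Definition is_homog_basis (D : der -> Prop) (theta1 theta2 : der) : Prop :=
  [/\ exists d, homog_der d theta1, exists d, homog_der d theta2
    & is_basis D theta1 theta2].

End LogarithmicFields.

Section Algorithm.
Variable K : fieldType.
Implicit Types (p f g q alpha : {mpoly K[2]}) (theta : der K).

(* p(alpha_y, - alpha_x), where alpha = alpha_x x + alpha_y y *)
Definition eval_at_ker alpha p : K :=
  p.@[tnth [tuple alpha@_U_(1); - alpha@_U_(0)]].

(* h = theta(alpha) / alpha^m; as S is a domain there is at most one such h
   when alpha != 0.                                                           *)
Definition is_quot alpha m theta (h : {mpoly K[2]}) : Prop :=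
  app_der theta alpha = h * alpha ^+ m.

Definition alg1_swap theta1 theta2 : der K * der K :=
  if (deg_der theta1 < deg_der theta2)%N then (theta2, theta1)
  else (theta1, theta2).

(* The truncated subtraction is exact after alg1_swap. *)
Definition alg1_choice alpha theta1 theta2 f g q : Prop :=
  q \is (deg_der theta1 - deg_der theta2)%N.-homog /\
  eval_at_ker alpha f + eval_at_ker alpha g * eval_at_ker alpha q = 0.

(* The part of ALG1 after the swap, as a relation between inputs and outputs:
   the choice of q makes it nondeterministic.                                 *)
Inductive alg1_main alpha m theta1 theta2 : der K -> der K -> Prop :=
| Alg1ScaleLeft g :
    is_quot alpha m theta2 g -> eval_at_ker alpha g = 0 ->
    alg1_main alpha m theta1 theta2 (alpha *: theta1) theta2
| Alg1ScaleRight g f :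
    is_quot alpha m theta2 g -> eval_at_ker alpha g <> 0 ->
    is_quot alpha m theta1 f -> eval_at_ker alpha f = 0 ->
    alg1_main alpha m theta1 theta2 theta1 (alpha *: theta2)
| Alg1Combine g f q :
    is_quot alpha m theta2 g -> eval_at_ker alpha g <> 0 ->
    is_quot alpha m theta1 f -> eval_at_ker alpha f <> 0 ->
    alg1_choice alpha theta1 theta2 f g q ->
    alg1_main alpha m theta1 theta2 (theta1 + q *: theta2) (alpha *: theta2).

(* Each quotient the procedure reaches is well defined, and a suitable q
   exists whenever one is requested.                                          *)
Definition alg1_main_defined alpha m theta1 theta2 : Prop :=
  (exists! g, is_quot alpha m theta2 g) /\
  forall g, is_quot alpha m theta2 g -> eval_at_ker alpha g <> 0 ->
    (exists! f, is_quot alpha m theta1 f) /\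
    forall f, is_quot alpha m theta1 f -> eval_at_ker alpha f <> 0 ->
      exists q, alg1_choice alpha theta1 theta2 f g q.

Definition alg1 alpha m theta1 theta2 : der K -> der K -> Prop :=
  alg1_main alpha m (alg1_swap theta1 theta2).1 (alg1_swap theta1 theta2).2.

Definition alg1_defined alpha m theta1 theta2 : Prop :=
  alg1_main_defined alpha m
    (alg1_swap theta1 theta2).1 (alg1_swap theta1 theta2).2.

End Algorithm.

(* Main.v *)
Require Import Defs.
From HB Require Import structures.
From mathcomp Require Import all_boot all_order all_algebra.
From mathcomp Require Import finmap mpoly.
From mathcomp Require Import ring.

Set Implicit Arguments.
Unset Strict Implicit.
Unset Printing Implicit Defensive.
Import GRing.Theory.
Local Open Scope ring_scope.

(** Write M for the multiarrangement with multiplicity mu, m = mu(ker alpha),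
    and M' for the result of adding the line ker alpha.  Raising m by one
    replaces D(M) by the submodule D(M') of those theta for which
    theta(alpha) / alpha^m is still divisible by alpha.  In coordinates with
    respect to a basis (theta1, theta2) of D(M), with quotients f and g, the
    derivation a theta1 + b theta2 lies in D(M') iff alpha divides a f + b g
    ([logder_add_lineP]).

    Since alpha is prime, this condition is transparent once alpha divides f
    but not g: it then says that alpha divides b, so that
    (theta1, alpha theta2) is a basis of D(M') ([is_basis_add_line]).  The
    three outcomes of the algorithm all reduce to this case: if alpha divides
    g, exchange theta1 and theta2; if it divides neither, the choice of q
    makes alpha divide f + q g, which is the quotient of theta1 + q theta2, and
    (theta1 + q theta2, theta2) is again a basis of D(M).  The swap ensures
    deg theta1 >= deg theta2, so that theta1 + q theta2 is homogeneous.

    Two facts make this work.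
    - alpha cannot divide both f and g ([basis_quot_not_both]): otherwise D(M)
      and D(M') would be equal, whereas if Q is the product of the powers
      beta^mu(ker beta) over the lines other than ker alpha, and d/dx_i is a
      partial derivation that does not kill alpha, then Q alpha^m d/dx_i is in
      D(M) but not in D(M').
    - f and g are homogeneous, and a homogeneous p is divisible by alpha iff
      p(alpha_y, - alpha_x) = 0 ([form_dvd_homog]).  A single evaluation does
      not detect divisibility of an arbitrary polynomial, such as the
      coefficients a and b above; for these, p is restricted to the whole line
      ker alpha, i.e. to the point (alpha_y t, - alpha_x t) with t an
      indeterminate.  Restriction is a ring morphism into a domain with kernel
      (alpha), so alpha is prime. *)

(** * Divisibility and homogeneity *)

Section Divisibility.
Context {K : fieldType}.
Implicit Types (p q r alpha beta : {mpoly K[2]}).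

Definition mpdvd q p : Prop := exists r, p = r * q.

Lemma mpdvd_add q p r : mpdvd q p -> mpdvd q r -> mpdvd q (p + r).
Proof. by move=> [a ->] [b ->]; exists (a + b); rewrite mulrDl. Qed.

Lemma mpdvd_mulr q p r : mpdvd q p -> mpdvd q (p * r).
Proof. by move=> [a ->]; exists (a * r); rewrite mulrAC. Qed.

Lemma mpdvd_mull q p r : mpdvd q r -> mpdvd q (p * r).
Proof. by rewrite mulrC; apply: mpdvd_mulr. Qed.

Lemma mpdvdZ q p c : mpdvd q p -> mpdvd q (c *: p).
Proof. by rewrite -mul_mpolyC; apply: mpdvd_mull. Qed.

Lemma ord2P (P : 'I_2 -> Prop) : P 0 -> P 1 -> forall i, P i.
Proof.
move=> P0 P1 [[|[|//]] hi].
  by rewrite (_ : Ordinal hi = 0) //; apply: val_inj.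
by rewrite (_ : Ordinal hi = 1) //; apply: val_inj.
Qed.

(** A factor of a homogeneous polynomial is homogeneous when the complementary
    factor is: only one graded piece of the quotient can contribute. *)
Lemma dhomog_quot d e p q : q != 0 -> q \is e.-homog -> p * q \is d.-homog ->
  p \is (d - e).-homog.
Proof.
move=> q0 hq hpq.
have defp : p = \sum_(k < msize p) pihomog mdeg k p.
  by apply: pihomog_partitionE.
(* The pieces with k + e != d are killed by taking the degree d part of p * q. *)
suff -> : p = \sum_(k < msize p | (k + e)%N == d) pihomog mdeg k p.
  by apply: rpred_sum => k /eqP <-; rewrite addnK; apply: pihomogP.
apply: (mulIf q0); rewrite -(pihomog_dE hpq) {1}defp !mulr_suml raddf_sum.
rewrite (bigID (fun k : 'I_(msize p) => (k + e)%N == d)) /=.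
rewrite [X in _ + X]big1 ?addr0 => [|k kd].
  apply: eq_bigr => k /eqP <-; apply: pihomog_dE.
  by apply: dhomogM => //; apply: pihomogP.
by apply: (pihomog_ne0 kd); apply: dhomogM => //; apply: pihomogP.
Qed.

End Divisibility.

(** * Restriction of polynomials to the kernel of a linear form *)

Section RestrictionToKernel.
Context {K : fieldType} (alpha : {mpoly K[2]}).
Hypotheses (alpha1 : alpha \is 1.-homog) (alpha0 : alpha != 0).
Implicit Types (p q r beta : {mpoly K[2]}).

Definition ker_vector : 'I_2 -> K := tnth [tuple alpha@_U_(1); - alpha@_U_(0)].
Local Notation w := ker_vector.

Lemma ker_vector_neq0 : exists i, w i != 0.
Proof.
apply/existsP; apply: contraNT alpha0 => /existsPn z.
have := z 0; have := z 1; rewrite !negbK /ker_vector !(tnth_nth 0) /= oppr_eq0.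
by move=> /eqP a0 /eqP a1; rewrite (linformE alpha1) a0 a1 !scale0r addr0.
Qed.

(** The line ker alpha is parametrized by t |-> t w.  Choosing the parameter
    t = 'X_i / w_i keeps the restriction inside the same polynomial ring, so
    that p can be compared with its restriction modulo alpha. *)
Definition restr_ker (i : 'I_2) p : {mpoly K[2]} :=
  p \mPo [tuple (w j / w i) *: 'X_i | j < 2].

HB.instance Definition _ i := GRing.RMorphism.copy (restr_ker i)
  (comp_mpoly [tuple (w j / w i) *: 'X_i | j < 2]).

Lemma restr_kerX i j : restr_ker i 'X_j = (w j / w i) *: 'X_i.
Proof. by rewrite /restr_ker comp_mpolyXU -tnth_nth tnth_mktuple. Qed.

Lemma restr_kerZ i c p : restr_ker i (c *: p) = c *: restr_ker i p.
Proof. by rewrite /restr_ker linearZ. Qed.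

Lemma restr_ker_form i : restr_ker i alpha = 0.
Proof.
rewrite (linformE alpha1) rmorphD /= !restr_kerZ !restr_kerX !scalerA -scalerDl.
rewrite /ker_vector !(tnth_nth 0) /= mulrA mulrA mulrN mulNr.
by rewrite [X in _ - X]mulrAC [_ * alpha@_U_(0)]mulrC mulrA subrr scale0r.
Qed.

(** It suffices to check the variables, and w_i x_j - w_j x_i is 0 or, up to
    sign, alpha. *)
Lemma restr_ker_congr i p : w i != 0 -> mpdvd alpha (p - restr_ker i p).
Proof.
move=> wi0.
pose P p := mpdvd alpha (p - restr_ker i p).
have PM q r : P q -> P r -> P (q * r).
  rewrite /P rmorphM => hq hr.
  rewrite (_ : _ - _ = (q - restr_ker i q) * r
      + restr_ker i q * (r - restr_ker i r)); last by ring.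
  by apply: mpdvd_add; [apply: mpdvd_mulr | apply: mpdvd_mull].
have P1 : P 1 by rewrite /P rmorph1 subrr; exists 0; rewrite mul0r.
have PX j : P 'X_j.
  rewrite /P restr_kerX.
  rewrite (_ : _ - _ = (w i)^-1 *: (w i *: 'X_j - w j *: 'X_i)); last first.
    by rewrite scalerBr !scalerA mulVf // scale1r [_ * w j]mulrC.
  apply: mpdvdZ; rewrite [alpha]linformE // /mpdvd.
  move: i j {wi0 P PM P1}; apply: ord2P; apply: ord2P;
    rewrite /ker_vector !(tnth_nth 0) /= ?subrr.
  - by exists 0; rewrite mul0r.
  - by exists 1; rewrite mul1r scaleNr opprK addrC.
  - by exists (-1); rewrite mulN1r scaleNr -opprD.
  - by exists 0; rewrite mul0r.
have PXm m : P 'X_[m].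
  rewrite (mpolyXE_id K m); elim/big_ind: _ => // j _.
  by elim: (m j) => [|k IH]; rewrite ?expr0 // exprS; apply: PM.
elim/mpolyind: p => [|c m p _ _ IH].
  by rewrite rmorph0 subrr; exists 0; rewrite mul0r.
rewrite rmorphD /= restr_kerZ opprD addrACA -scalerBr.
by apply: mpdvd_add => //; apply: mpdvdZ; apply: PXm.
Qed.

Lemma restr_ker_eq0 i p : w i != 0 -> restr_ker i p = 0 <-> mpdvd alpha p.
Proof.
move=> wi0; split=> [h|[r ->]].
  by have := restr_ker_congr p wi0; rewrite h subr0.
by rewrite rmorphM /= restr_ker_form mulr0.
Qed.

Lemma form_prime p q : mpdvd alpha (p * q) -> mpdvd alpha p \/ mpdvd alpha q.
Proof.
have [i wi0] := ker_vector_neq0.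
move=> /(restr_ker_eq0 _ wi0) /eqP; rewrite rmorphM mulf_eq0.
by case/orP => /eqP /(restr_ker_eq0 _ wi0); [left | right].
Qed.

Lemma form_ndvd1 : ~ mpdvd alpha 1.
Proof.
have [i wi0] := ker_vector_neq0.
by move=> /(restr_ker_eq0 _ wi0) /eqP; rewrite rmorph1 oner_eq0.
Qed.

Lemma form_ndvd_exp p k : ~ mpdvd alpha p -> ~ mpdvd alpha (p ^+ k).
Proof.
move=> hp; elim: k => [|k IH]; first by rewrite expr0; apply: form_ndvd1.
by rewrite exprS => /form_prime [].
Qed.

(** Homogeneity of degree d gives p(t w) = p(w) t^d, so the restriction of p
    vanishes as a polynomial in t as soon as p(w) does. *)
Lemma form_dvd_homog d p : p \is d.-homog ->
  mpdvd alpha p <-> eval_at_ker alpha p = 0.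
Proof.
have [i wi0] := ker_vector_neq0; move=> hp.
suff e : restr_ker i p = eval_at_ker alpha p *: ((w i)^-1 *: 'X_i) ^+ d.
  rewrite -(restr_ker_eq0 _ wi0) e; split=> [/eqP|->]; last by rewrite scale0r.
  rewrite scaler_eq0 expf_eq0 scaler_eq0 invr_eq0 (negPf wi0) /=.
  by rewrite -msize_poly_eq0 msizeX andbF orbF => /eqP.
rewrite /restr_ker comp_mpolyE /eval_at_ker mevalE scaler_suml.
rewrite [LHS]big_seq [RHS]big_seq; apply: eq_bigr => m hm.
rewrite -scalerA; congr (_ *: _).
have <- : mdeg m = d by move/dhomogP: hp; apply.
rewrite mdegE -prodrXr -scaler_prod; apply: eq_bigr => j _.
by rewrite tnth_mktuple -exprZn scalerA.
Qed.

Lemma eval_at_ker_form beta : beta \is 1.-homog ->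
  eval_at_ker alpha beta =
    beta@_U_(0) * alpha@_U_(1) - beta@_U_(1) * alpha@_U_(0).
Proof.
move=> h; rewrite /eval_at_ker {1}(linformE h) mevalD !mevalZ !mevalXU.
by rewrite !(tnth_nth 0) /= mulrN.
Qed.

End RestrictionToKernel.

(** * Lines and the forms that define them *)

Section LinesAndForms.
Context {K : fieldType}.
Implicit Types (alpha beta : {mpoly K[2]}).

(** If the kernels agree, then beta vanishes at (alpha_y, - alpha_x), a vector
    of ker alpha; in the other direction, ker alpha is contained in ker beta
    and both are lines. *)
Lemma kerform_eqP alpha beta :
    alpha \is 1.-homog -> alpha != 0 -> beta \is 1.-homog -> beta != 0 ->
  kerform beta = kerform alpha <-> mpdvd alpha beta.
Proof.
move=> a1 a0 b1 b0; rewrite (form_dvd_homog a1 a0 b1); split=> [e|e].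
  pose v : 'rV[K]_2 := \row_j tnth [tuple alpha@_U_(1); - alpha@_U_(0)] j.
  have hv gamma : eval_at_ker alpha gamma = gamma.@[v 0].
    by apply: meval_eq => j; rewrite mxE.
  rewrite hv; apply/eqP; rewrite -mem_kerform // e mem_kerform // -hv.
  by rewrite eval_at_ker_form // mulrC subrr.
have [r hr] := (form_dvd_homog a1 a0 b1).2 e.
apply/eqP; rewrite eq_sym eqEdim !dim_kerform // leqnn andbT.
apply/subvP => v; rewrite !mem_kerform // => /eqP av.
by rewrite hr mevalM av mulr0.
Qed.

(** Unlike [kerform_eqP], this form can be fed to a derivation: theta(c alpha)
    = c theta(alpha) only holds for a constant c. *)
Lemma kerform_eq_scale alpha beta :
    alpha \is 1.-homog -> alpha != 0 -> beta \is 1.-homog -> beta != 0 ->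
  kerform beta = kerform alpha -> exists2 c : K, c != 0 & beta = c *: alpha.
Proof.
move=> a1 a0 b1 b0 /(kerform_eqP a1 a0 b1 b0) [r br].
have r0 : r != 0 by apply: contraNneq b0 => r0; rewrite br r0 mul0r.
have hr : r \is (1 - 1).-homog by apply: (dhomog_quot a0 a1); rewrite -br.
have /msize_poly1P [c c0 rc] : msize r == 1%N.
  have := dhomog_uniq r0 hr (dhomog_msize hr).
  by move: r0; rewrite -msize_poly_eq0; case: (msize r) => //= k _ <-.
by exists c => //; rewrite br rc mul_mpolyC.
Qed.

(** The form v_y x - v_x y vanishes on the line spanned by v. *)
Lemma line_kerform (H : {vspace 'rV[K]_2}) : \dim H = 1%N ->
  exists beta, [/\ beta \is 1.-homog, beta != 0 & kerform beta = H].
Proof.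
move=> dH; pose v := vpick H.
have v0 : v != 0 by rewrite vpick0 -dimv_eq0 dH.
pose beta : {mpoly K[2]} := v 0 1 *: 'X_(0 : 'I_2) - v 0 0 *: 'X_(1 : 'I_2).
have b1 : beta \is 1.-homog.
  by rewrite rpredB // rpredZ // dhomogX; apply/eqP/mdeg1.
have ev u : beta.@[u] = v 0 1 * u 0 - v 0 0 * u 1.
  by rewrite mevalB !mevalZ !mevalXU.
have b0 : beta != 0.
  apply: contra v0 => /eqP b0; apply/eqP/rowP; apply: ord2P; rewrite mxE.
    have := ev (fun i => (i == 1)%:R); rewrite b0 meval0 /= mulr0 mulr1 sub0r.
    by move/esym/eqP; rewrite oppr_eq0 => /eqP.
  have := ev (fun i => (i == 0)%:R).
  by rewrite b0 meval0 /= mulr0 mulr1 subr0 => /esym.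
exists beta; split=> //.
have dv : \dim <[v]> = 1%N by rewrite dim_vline v0.
have -> : H = <[v]>%VS.
  by apply/eqP; rewrite eq_sym eqEdim dv dH leqnn andbT -memvE memv_pick.
apply/eqP; rewrite eq_sym eqEdim dv dim_kerform // leqnn andbT -memvE.
by rewrite mem_kerform // ev mulrC subrr.
Qed.

End LinesAndForms.

(** * Logarithmic derivations and their bases *)

Section LogarithmicDerivations.
Context {K : fieldType}.
Implicit Types (p q alpha beta : {mpoly K[2]}) (theta : der K).

Lemma app_der_comb a b theta1 theta2 p :
  app_der (a *: theta1 + b *: theta2) p =
  a * app_der theta1 p + b * app_der theta2 p.
Proof. by rewrite /app_der !mxE; ring. Qed.

Lemma app_derZ a theta p : app_der (a *: theta) p = a * app_der theta p.
Proof. by rewrite /app_der !mxE; ring. Qed.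

Lemma app_der_scale theta c p : app_der theta (c *: p) = c *: app_der theta p.
Proof. by rewrite /app_der !mderivZ -!scalerAr -scalerDr. Qed.

Lemma mderiv_form alpha i : alpha \is 1.-homog ->
  alpha^`M(i) = (alpha@_U_(i))%:MP.
Proof.
move=> h; rewrite {1}(linformE h) mderivD !mderivZ !mderivX !mnm1E.
have U0 (j : 'I_2) : (U_(j) - U_(j))%MM = 0%MM.
  by apply/mnmP => k; rewrite mnmBE mnm0E subnn.
move: i; apply: ord2P; rewrite /= ?scale0r ?scaler0 ?addr0 ?add0r U0 scale1r.
  by rewrite -mul_mpolyC mpolyX0 mulr1.
by rewrite -mul_mpolyC mpolyX0 mulr1.
Qed.

Lemma dhomog_app_der d theta alpha : (forall i, theta 0 i \is d.-homog) ->
  alpha \is 1.-homog -> app_der theta alpha \is d.-homog.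
Proof.
move=> h a1; rewrite /app_der !mderiv_form // ![_ * _%:MP]mulrC !mul_mpolyC.
by rewrite rpredD // rpredZ.
Qed.

Lemma logder_comb (M : multiarr K) a b theta1 theta2 :
  logder M theta1 -> logder M theta2 ->
  logder M (a *: theta1 + b *: theta2).
Proof.
move=> h1 h2 beta b1 b0; rewrite app_der_comb.
by apply: mpdvd_add; apply: mpdvd_mull; [apply: h1 | apply: h2].
Qed.

Lemma is_basis_sym (D : der K -> Prop) theta1 theta2 :
  is_basis D theta1 theta2 -> is_basis D theta2 theta1.
Proof.
move=> [D1 D2 span free]; split=> // [theta /span [a [b ->]]|a b e].
  by exists b, a; rewrite addrC.
by have [] := free b a; rewrite // addrC.
Qed.

(** An elementary change of basis; coordinates (a, b) become (a, b - a q). *)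
Lemma is_basis_transvection (M : multiarr K) q theta1 theta2 :
  is_basis (logder M) theta1 theta2 ->
  is_basis (logder M) (theta1 + q *: theta2) theta2.
Proof.
move=> [D1 D2 span free]; split=> // [|theta /span [a [b ->]]|a b].
- by rewrite -[theta1]scale1r; apply: logder_comb.
- exists a, (b - a * q).
  by rewrite scalerDr scalerA -addrA -scalerDl [a * q + _]addrC subrK.
rewrite scalerDr scalerA -addrA -scalerDl => /free [-> ].
by rewrite mul0r add0r.
Qed.

End LogarithmicDerivations.

(** * Raising the multiplicity of one line *)

Section AddLine.
Context {K : fieldType} (M : multiarr K) (alpha : {mpoly K[2]}).
Hypotheses (alpha1 : alpha \is 1.-homog) (alpha0 : alpha != 0).
Implicit Types (p q f g beta : {mpoly K[2]}) (theta : der K).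
Local Notation m := (M (kerform alpha)).
Local Notation M' := (add_line M alpha1 alpha0).

(** Only the forms proportional to alpha see the change of multiplicity, and a
    nonzero scalar does not affect divisibility. *)
Lemma logder_add_lineP theta f : is_quot alpha m theta f ->
  logder M' theta <-> logder M theta /\ mpdvd alpha f.
Proof.
move=> tf; split=> [h|[h [r fr]] beta b1 b0].
  split=> [beta b1 b0|]; last first.
    have [r /=] := h alpha alpha1 alpha0; rewrite /add_mult eqxx tf exprS mulrA.
    by move/(mulIf (expf_neq0 m alpha0)) => ->; exists r.
  have [r /=] := h beta b1 b0; rewrite /add_mult; case: eqP => [->|_] ->.
    by exists (r * beta); rewrite exprS mulrA.
  by exists r.
rewrite /= /add_mult; case: eqP => [|_]; last exact: h.
case/kerform_eq_scale => // c c0 ->.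
rewrite app_der_scale tf fr exprZn; exists ((c * (c ^+ m.+1)^-1) *: r).
rewrite -scalerAl -scalerAr scalerA mulfVK ?expf_neq0 //.
by rewrite -mulrA -exprS.
Qed.

(** Q is the product, over the lines H of the arrangement other than ker alpha,
    of b_H^mu(H), where b_H defines H.  It is not divisible by alpha because
    alpha is prime and divides no b_H. *)
Lemma other_lines_product : exists Q : {mpoly K[2]}, ~ mpdvd alpha Q /\
  forall beta, beta \is 1.-homog -> beta != 0 ->
    kerform beta <> kerform alpha -> mpdvd (beta ^+ M (kerform beta)) Q.
Proof.
(* Restricting the condition to kernels in the list of lines of M makes the
   product accessible to induction on that list; mu is 0 off the list. *)
suff [Q [aQ hQ]] : exists Q : {mpoly K[2]}, ~ mpdvd alpha Q /\
    forall beta, beta \is 1.-homog -> beta != 0 ->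
      kerform beta \in (marr M : seq _) -> kerform beta <> kerform alpha ->
      mpdvd (beta ^+ M (kerform beta)) Q.
  exists Q; split=> // beta b1 b0 ba.
  have [/hQ|] := boolP (kerform beta \in marr M); first exact.
  rewrite marr_suppP negbK => /eqP ->; exists Q; by rewrite expr0 mulr1.
have: {in (marr M : seq _), forall H, \dim H = 1%N} by exact: marr_dim.
elim: (marr M : seq _) => [|H s IH] hs.
  by exists 1; split=> //; apply: form_ndvd1.
have [|Q [aQ hQ]] := IH; first by move=> G Gs; apply: hs; rewrite inE Gs orbT.
have [Ha|Ha] := eqVneq H (kerform alpha).
  exists Q; split=> // beta b1 b0; rewrite inE Ha => /orP [/eqP -> //|].
  exact: hQ.
have [gamma [c1 c0 cH]] : exists gamma, [/\ gamma \is 1.-homog, gamma != 0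
    & kerform gamma = H] by apply/line_kerform/hs/mem_head.
exists (gamma ^+ M H * Q); split.
  case/(form_prime alpha1 alpha0) => //; apply: form_ndvd_exp => //.
  by move/(kerform_eqP alpha1 alpha0 c1 c0)/eqP; rewrite cH (negPf Ha).
move=> beta b1 b0; rewrite inE => /orP [/eqP bH _|bs ba]; last first.
  by apply: mpdvd_mull; apply: hQ.
apply: mpdvd_mulr; rewrite bH.
have [c _ ->] := kerform_eq_scale b1 b0 c1 c0 (etrans cH (esym bH)).
by rewrite exprZn; apply: mpdvdZ; exists 1; rewrite mul1r.
Qed.

(** Some element of D(M) has no more than the required divisibility by alpha:
    Q alpha^m d/dx_i, with Q as in [other_lines_product] and i a variable that
    occurs in alpha. *)
Lemma exists_logder_sharp : exists theta f,
  [/\ logder M theta, is_quot alpha m theta f & ~ mpdvd alpha f].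
Proof.
have [Q [aQ hQ]] := other_lines_product.
have [i ai0] : exists i, alpha@_U_(i) != 0.
  apply/existsP; apply: contraNT alpha0 => /existsPn z; rewrite (linformE alpha1).
  by have := z 0; have := z 1; rewrite !negbK => /eqP-> /eqP->; rewrite !scale0r addr0.
have appE beta : app_der ((Q * alpha ^+ m) *: delta_mx 0 i) beta
    = Q * beta^`M(i) * alpha ^+ m.
  rewrite app_derZ mulrAC; congr (_ * _ * _); rewrite /app_der !mxE /=.
  by move: i {ai0}; apply: ord2P; rewrite /= ?mul1r ?mul0r ?addr0 ?add0r.
exists ((Q * alpha ^+ m) *: delta_mx 0 i), (alpha@_U_(i) *: Q); split.
- move=> beta b1 b0; rewrite appE.
  case: (eqVneq (kerform beta) (kerform alpha)) => [e|/eqP ba].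
    apply: mpdvd_mull; rewrite e.
    have [c _ ->] := kerform_eq_scale b1 b0 alpha1 alpha0 (esym e).
    by rewrite exprZn; apply: mpdvdZ; exists 1; rewrite mul1r.
  by do 2!apply: mpdvd_mulr; apply: hQ.
- by rewrite /is_quot appE mderiv_form // [Q * _]mulrC mul_mpolyC.
by move/(mpdvdZ (alpha@_U_(i))^-1); rewrite scalerA mulVf // scale1r.
Qed.

Lemma is_quot_comb n theta1 theta2 f g a b :
  is_quot alpha n theta1 f -> is_quot alpha n theta2 g ->
  is_quot alpha n (a *: theta1 + b *: theta2) (a * f + b * g).
Proof.
by rewrite /is_quot app_der_comb => -> ->; rewrite mulrDl !mulrA.
Qed.

Lemma is_quot_inj n theta f g :
  is_quot alpha n theta f -> is_quot alpha n theta g -> f = g.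
Proof.
by rewrite /is_quot => -> /(mulIf (expf_neq0 n alpha0)).
Qed.

Lemma dhomog_is_quot d n theta f : homog_der d theta ->
  is_quot alpha n theta f -> f \is (d - n).-homog.
Proof.
move=> [_ h] tf; apply: (dhomog_quot (expf_neq0 n alpha0)).
  by have := dhomogMn n alpha1; rewrite mul1n.
by rewrite -tf; apply: dhomog_app_der.
Qed.

(** A common factor alpha of f and g would divide the quotient of every element
    of D(M), contrary to [exists_logder_sharp]. *)
Lemma basis_quot_not_both theta1 theta2 f g :
    is_basis (logder M) theta1 theta2 ->
    is_quot alpha m theta1 f -> is_quot alpha m theta2 g ->
  mpdvd alpha f -> ~ mpdvd alpha g.
Proof.
move=> [_ _ span _] tf tg af ag.
have [theta [h [/span [a [b ->]] th ah]]] := exists_logder_sharp.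
apply: ah; rewrite (is_quot_inj th (is_quot_comb a b tf tg)).
by apply: mpdvd_add; apply: mpdvd_mull.
Qed.

(** Membership of a theta1 + b theta2 in D(M') reads alpha | a f + b g, hence
    alpha | b g, hence alpha | b as alpha is prime and does not divide g. *)
Lemma is_basis_add_line theta1 theta2 f g :
    is_basis (logder M) theta1 theta2 ->
    is_quot alpha m theta1 f -> is_quot alpha m theta2 g -> mpdvd alpha f ->
  is_basis (logder M') theta1 (alpha *: theta2).
Proof.
move=> bas tf tg af; have ag := basis_quot_not_both bas tf tg af.
case: bas => D1 D2 span free; split=> [||theta Dt|a b].
- by apply/(logder_add_lineP tf).
- have := is_quot_comb 0 alpha tf tg; rewrite scale0r mul0r !add0r => tag.
  apply/(logder_add_lineP tag); split; last by exists g; rewrite mulrC.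
  by have := logder_comb 0 alpha D1 D2; rewrite scale0r add0r.
- have Mt : logder M theta.
    have [h] := Dt _ alpha1 alpha0; rewrite /= /add_mult eqxx exprS mulrA => th.
    by case: ((logder_add_lineP th).1 Dt).
  have [a [b e]] := span _ Mt; have th := is_quot_comb a b tf tg.
  rewrite -e in th; have [_ [r hr]] := (logder_add_lineP th).1 Dt.
  have : mpdvd alpha (b * g).
    rewrite (_ : b * g = (a * f + b * g) + (- a) * f); last by ring.
    by apply: mpdvd_add; [exists r | apply: mpdvd_mull].
  case/(form_prime alpha1 alpha0) => // -[s bs].
  by exists a, s; rewrite scalerA -bs.
rewrite scalerA => /free [-> /eqP]; rewrite mulf_eq0 (negPf alpha0) orbF.
by move/eqP.
Qed.

Lemma homog_der_scale d theta :
  homog_der d theta -> homog_der d.+1 (alpha *: theta).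
Proof.
move=> [nz h]; split=> [|i]; last by rewrite mxE; apply: (dhomogM alpha1 (h i)).
apply: contra nz => /eqP /rowP e; apply/eqP/rowP => i; apply/eqP.
by have := e i; rewrite !mxE => /eqP; rewrite mulf_eq0 (negPf alpha0).
Qed.

(** A power of a variable that does not vanish at (alpha_y, - alpha_x) takes
    every value there after scaling. *)
Lemma exists_homog_eval e (c : K) : exists2 q : {mpoly K[2]},
  q \is e.-homog & eval_at_ker alpha q = c.
Proof.
have [i wi0] := ker_vector_neq0 alpha1 alpha0.
exists ((c / ker_vector alpha i ^+ e) *: 'X_i ^+ e).
  have X1 : ('X_i : {mpoly K[2]}) \is 1.-homog by rewrite dhomogX; apply/eqP/mdeg1.
  by rewrite rpredZ //; have := dhomogMn e X1; rewrite mul1n.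
rewrite /eval_at_ker mevalZ rmorphXn /= mevalXU.
by rewrite divfK // expf_neq0.
Qed.

End AddLine.

(** * The algorithm *)

Section Alg1.
Context {K : fieldType} (M : multiarr K) (alpha : {mpoly K[2]}).
Hypotheses (alpha1 : alpha \is 1.-homog) (alpha0 : alpha != 0).
Implicit Types (f g : {mpoly K[2]}) (theta : der K).
Local Notation m := (M (kerform alpha)).
Local Notation M' := (add_line M alpha1 alpha0).

Lemma logder_is_quot theta : logder M theta ->
  exists! f, is_quot alpha m theta f.
Proof.
move=> h; have [f tf] := h _ alpha1 alpha0; exists f; split=> // g.
exact: is_quot_inj tf.
Qed.

Lemma alg1_main_definedP theta1 theta2 :
  is_homog_basis (logder M) theta1 theta2 ->
  alg1_main_defined alpha m theta1 theta2.
Proof.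
move=> [_ _ [D1 D2 _ _]]; split=> [|g _ /eqP g0]; first exact: logder_is_quot.
split=> [|f _ _]; first exact: logder_is_quot.
have [q hq eq] := exists_homog_eval alpha1 alpha0
  (deg_der theta1 - deg_der theta2) (- eval_at_ker alpha f / eval_at_ker alpha g).
by exists q; split=> //; rewrite eq mulrC divfK // subrr.
Qed.

Lemma alg1_mainP theta1 theta2 theta1' theta2' :
    is_homog_basis (logder M) theta1 theta2 ->
    (deg_der theta2 <= deg_der theta1)%N ->
  alg1_main alpha m theta1 theta2 theta1' theta2' ->
  is_homog_basis (logder M') theta1' theta2'.
Proof.
move=> [[d1 h1] [d2 h2] bas] le_d alg.
have [D1 D2 _ _] := bas.
have [f0 [tf0 _]] := logder_is_quot D1.
have dvdP d theta f (h : homog_der d theta) (tf : is_quot alpha m theta f) :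
    eval_at_ker alpha f = 0 -> mpdvd alpha f.
  by move/(form_dvd_homog alpha1 alpha0 (dhomog_is_quot alpha1 alpha0 h tf)).
case: alg => [g tg g0|g f tg _ tf f0'|g f q tg g0 tf _ [hq e]].
- split; [by exists d1.+1; apply: homog_der_scale | by exists d2 |].
  apply/is_basis_sym/(is_basis_add_line _ _ (is_basis_sym bas) tg tf0).
  exact: (dvdP _ _ _ h2 tg g0).
- split; [by exists d1 | by exists d2.+1; apply: homog_der_scale |].
  by apply: (is_basis_add_line _ _ bas tf tg); apply: (dvdP _ _ _ h1 tf).
have bas' := is_basis_transvection q bas.
have h : homog_der d1 (theta1 + q *: theta2).
  split=> [|i].
    apply/eqP => z; have [_ _ _ free] := bas.
    by have [|/eqP] := free 1 q; rewrite ?scale1r ?oner_eq0.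
  rewrite !mxE rpredD //; first exact: h1.2.
  (* The subtraction in the degree of q is exact by le_d. *)
  move: hq le_d; rewrite (deg_derE h1) (deg_derE h2) => hq le_d.
  by rewrite -(subnK le_d); apply: dhomogM => //; apply: h2.2.
have tfq : is_quot alpha m (theta1 + q *: theta2) (f + q * g).
  by have := is_quot_comb 1 q tf tg; rewrite scale1r mul1r.
split; [by exists d1 | by exists d2.+1; apply: homog_der_scale |].
apply: (is_basis_add_line _ _ bas' tfq tg); apply: (dvdP _ _ _ h tfq).
by rewrite /eval_at_ker mevalD mevalM mulrC.
Qed.

End Alg1.

Theorem theorem3p1 (K : fieldType) (M : multiarr K) (alpha : {mpoly K[2]})
    (alpha1 : alpha \is 1.-homog) (alpha0 : alpha != 0) (theta1 theta2 : der K)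
    (basis12 : is_homog_basis (logder M) theta1 theta2) :
  alg1_defined alpha (M (kerform alpha)) theta1 theta2 /\
  forall theta1' theta2' : der K,
    alg1 alpha (M (kerform alpha)) theta1 theta2 theta1' theta2' ->
    is_homog_basis (logder (add_line M alpha1 alpha0)) theta1' theta2'.
Proof.
rewrite /alg1_defined /alg1 /alg1_swap.
case: ltnP => [/ltnW lt_d|le_d] /=; last first.
  by split=> [|? ?]; [exact: alg1_main_definedP | exact: alg1_mainP].
have basis21 : is_homog_basis (logder M) theta2 theta1.
  by case: basis12 => h1 h2 /is_basis_sym.
by split=> [|? ?]; [exact: alg1_main_definedP | exact: alg1_mainP].
Qed.
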